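(* Let $\mathcal{M}=\{m_u\mid u\in P\}$ be an order monomial family in $S=\mathbb{K}[x_1,\dots,x_n]$ and $\mathcal{I}=\langle\mathcal{M}\rangle$. Then the homological order complex $C_*(\mathcal{M})$ is a free resolution of $\mathcal{I}$ (i.e. the sequence $\cdots\to C_2\to C_1\to C_0=S\to S/\mathcal{I}\to0$ is exact). If moreover $m_{\{u_1,\dots,u_k\}}\neq m_{\{u_1,\dots,\widehat{u_i},\dots,u_k\}}$ for every strictly increasing chain $u_1\lneq\cdots\lneq u_k$ in $P$ and every $i=1,\dots,k$, then $C_*(\mathcal{M})$ is a minimal free resolution of $\mathcal{I}$.
   Context: $\mathbb{K}$ is a field. $P$ is a finite poset and $\mathcal{M}=\{m_u\mid u\in P\}$ is a collection of monomials; $M_u$ denotes the set of monomials divisible by $m_u$. $\mathcal{M}$ is an order monomial family (and $\mathcal{I}$ an order monomial ideal) if (OM): for any $u,v\in P$ there is $w\in P$ with $w\ge u$, $w\ge v$ and $M_u\cap M_v\subseteq M_w$ (i.e. $m_w$ divides $\mathrm{lcm}(m_u,m_v)$). For $U\subseteq P$, $m_U=\mathrm{lcm}(m_u\mid u\in U)$ (with $m_\emptyset=1$) and $a_U\in\mathbb{Z}^n$ is its exponent vector. For $a\in\mathbb{Z}_{\ge0}^n$, $S(-a)=x^aS$ is the free $\mathbb{Z}^n$-graded $S$-module generated by $x^a$. The homological order complex $C_*(\mathcal{M})$ is $\cdots\xrightarrow{\partial_3}C_2\xrightarrow{\partial_2}C_1\xrightarrow{\partial_1}C_0=S\to S/\mathcal{I}\to0$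 with $C_k=\bigoplus_{u_1\lneq\cdots\lneq u_k}S(-a_{\{u_1,\dots,u_k\}})$ (sum over strictly increasing $k$-chains in $P$), and $\partial_k$ on the summand indexed by $u_1\lneq\cdots\lneq u_k$ equal to $\sum_{i=1}^k(-1)^iE_i$, where $E_i:S(-a_{\{u_1,\dots,u_k\}})\hookrightarrow S(-a_{\{u_1,\dots,\widehat{u_i},\dots,u_k\}})$ is the natural inclusion into the summand indexed by the chain with $u_i$ removed. *)

(* Defs.v *)
From HB Require Import structures.
From mathcomp Require Import all_boot all_order all_algebra.
From mathcomp Require Import ring_quotient generic_quotient.
From mathcomp Require Import mpoly.
From mathcomp Require boolp.
From mathcomp Require Import zify.

Set Implicit Arguments.
Unset Strict Implicit.
Unset Printing Implicit Defensive.

Import Order.TTheory GRing.Theory.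
Local Open Scope ring_scope.
Local Open Scope quotient_scope.

Section QuotientModule.
Variables (R : pzRingType) (V : lmodType R) (W : submodClosed V).

(* A copy of [W], since [submodClosed] does not record closure under opposite,
   which [Quotient.quot] needs. *)
Definition submod_pred : {pred V} := W.

Fact submod_pred_zmod : zmod_closed submod_pred.
Proof.
split=> [|u v uW vW]; first exact: (rpred0 W).
by apply: (@rpredD _ W) => //; rewrite -scaleN1r; apply: (@rpredZ _ _ W).
Qed.

HB.instance Definition _ := GRing.isZmodClosed.Build V submod_pred
  submod_pred_zmod.

(* The library only puts an abelian group structure on this quotient (or a ring
   structure, but then only for proper ideals). *)
Definition quotmod : Type := Quotient.quot submod_pred.

HB.instance Definition _ := GRing.Zmodule.on quotmod.

Definition quotmod_pi (v : V) : quotmod := \pi_(Quotient.quot submod_pred) v.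

Definition quotmod_scale (a : R) (x : quotmod) : quotmod :=
  quotmod_pi (a *: repr (x : Quotient.quot submod_pred)).

Lemma quotmod_piP (u v : V) :
  reflect (quotmod_pi u = quotmod_pi v) (u - v \in W).
Proof.
have -> : (u - v \in W) = (u - v \in submod_pred) by [].
by rewrite Quotient.idealrBE; exact: eqP.
Qed.

Lemma quotmod_piD : {morph quotmod_pi : u v / u + v}.
Proof. by move=> u v; rewrite /quotmod_pi; exact: Quotient.pi_add. Qed.

Lemma quotmod_repr (x : quotmod) : exists v, x = quotmod_pi v.
Proof. by exists (repr (x : Quotient.quot submod_pred)); rewrite /quotmod_pi reprK. Qed.

Lemma quotmod_piZ a v : quotmod_scale a (quotmod_pi v) = quotmod_pi (a *: v).
Proof.
apply/quotmod_piP; rewrite -scalerBr rpredZ //; apply/quotmod_piP.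
by rewrite /quotmod_pi reprK.
Qed.

Fact quotmod_scalerA a b x :
  quotmod_scale a (quotmod_scale b x) = quotmod_scale (a * b) x.
Proof. by have [v ->] := quotmod_repr x; rewrite !quotmod_piZ scalerA. Qed.

Fact quotmod_scale1r : left_id 1 quotmod_scale.
Proof.
by move=> x; have [v ->] := quotmod_repr x; rewrite quotmod_piZ scale1r.
Qed.

Fact quotmod_scalerDr : right_distributive quotmod_scale +%R.
Proof.
move=> a x y; have [u ->] := quotmod_repr x; have [v ->] := quotmod_repr y.
by rewrite -quotmod_piD !quotmod_piZ scalerDr quotmod_piD.
Qed.

Fact quotmod_scalerDl x : {morph quotmod_scale^~ x : a b / a + b}.
Proof.
move=> a b; have [u ->] := quotmod_repr x.
by rewrite !quotmod_piZ scalerDl quotmod_piD.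
Qed.

HB.instance Definition _ := GRing.Zmodule_isLmodule.Build R quotmod
  quotmod_scalerA quotmod_scale1r quotmod_scalerDr quotmod_scalerDl.

Fact quotmod_pi_linear : linear quotmod_pi.
Proof. by move=> a u v; rewrite quotmod_piD -quotmod_piZ. Qed.

HB.instance Definition _ :=
  GRing.isLinear.Build R V quotmod _ quotmod_pi quotmod_pi_linear.

End QuotientModule.

Arguments quotmod {R V} W.
Arguments quotmod_pi {R V} W v.

Definition finite_free (R : pzRingType) (V : lmodType R) : Prop :=
  exists (I : finType) (e : I -> V),
    forall v : V, exists! c : {ffun I -> R}, v = \sum_i c i *: e i.

Definition free_resolution (R : pzRingType) (F : nat -> lmodType R)
    (d : forall k, {linear F k.+1 -> F k})
    (V : lmodType R) (aug : {linear F 0%N -> V}) : Prop :=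
  [/\ forall k, finite_free (F k),
      forall v : V, exists x, aug x = v,
      forall x : F 0%N, aug x = 0 <-> exists y, d 0%N y = x
    & forall k (x : F k.+1), d k x = 0 <-> exists y, d k.+1 y = x].

(* Minimality is the condition d(F_{k+1}) ⊆ (x_1, ..., x_n) F_k. *)
Definition minimal_free_resolution (K : fieldType) (n : nat)
    (F : nat -> lmodType {mpoly K[n]}) (d : forall k, {linear F k.+1 -> F k})
    (V : lmodType {mpoly K[n]}) (aug : {linear F 0%N -> V}) : Prop :=
  free_resolution d aug /\
  forall k (x : F k.+1),
    exists y : 'I_n -> F k, d k x = \sum_(i < n) ('X_i : {mpoly K[n]}) *: y i.

Section Chains.
Context {disp : Order.disp_t} (P : finPOrderType disp).

Definition chain (k : nat) : Type := {c : k.-tuple P | sorted <%O c}.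

HB.instance Definition _ k := Finite.on (chain k).

Definition chain_set k (c : chain k) : {set P} := [set u in val c].

Fact chain_del_subproof k (c : chain k.+1) (i : 'I_k.+1) :
  sorted <%O [tuple tnth (val c) (lift i j) | j < k].
Proof.
case: c => c /= c_sorted.
rewrite sorted_map; apply: (@sub_sorted _ (fun a b : 'I_k => (a < b)%N)).
  move: (tnth c i) => x0 a b lt_ab; rewrite /relpre /= !(tnth_nth x0).
  apply: (sorted_ltn_nth lt_trans) => //.
  - by rewrite inE size_tuple; exact: (ltn_ord (lift i a)).
  - by rewrite inE size_tuple; exact: (ltn_ord (lift i b)).
  - by rewrite /= /bump; case: (leqP i a); case: (leqP i b); lia.
by have := iota_ltn_sorted 0 k; rewrite -val_enum_ord sorted_map enumT.
Qed.

Definition chain_del k (c : chain k.+1) (i : 'I_k.+1) : chain k :=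
  exist (fun c : k.-tuple P => sorted <%O c) _ (chain_del_subproof c i).

Lemma chain_set_del k (c : chain k.+1) i :
  chain_set (chain_del c i) \subset chain_set c.
Proof.
apply/subsetP=> u; rewrite !inE /= => /mapP[j _ ->]; exact: mem_tnth.
Qed.

Fact chain0_subproof : sorted <%O ([tuple] : 0.-tuple P).
Proof. by []. Qed.

Definition chain0 : chain 0 :=
  exist (fun c : 0.-tuple P => sorted <%O c) _ chain0_subproof.

End Chains.

Section MlcmLaw.
Variable n : nat.

Fact mlcmA : associative (@mlcm n).
Proof. by move=> a b c; apply/mnmP=> i; rewrite !mnmE maxnA. Qed.

HB.instance Definition _ :=
  Monoid.isComLaw.Build 'X_{1..n} 0%MM (@mlcm n) mlcmA (@mlcmC n) (@mlc0m n).

End MlcmLaw.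

Section OrderMonomial.
Context {disp : Order.disp_t} {P : finPOrderType disp} {n : nat}.
Variable m : P -> 'X_{1..n}.

(* [(a <= b)%MM] is divisibility of monomials. *)
Definition order_monomial_family : Prop :=
  forall u v : P, exists w : P, [/\ (u <= w)%O, (v <= w)%O &
    forall t : 'X_{1..n}, (m u <= t)%MM -> (m v <= t)%MM -> (m w <= t)%MM].

Definition lcm_mon (U : {set P}) : 'X_{1..n} :=
  \big[@mlcm n/0%MM]_(u in U) m u.

Lemma lcm_monS (U V : {set P}) : U \subset V -> (lcm_mon U <= lcm_mon V)%MM.
Proof.
move=> sUV; rewrite /lcm_mon.
apply: (big_ind (fun t => (t <= \big[@mlcm n/0%MM]_(u in V) m u)%MM)).
- by apply/mnm_lepP=> i; rewrite mnmE.
- by move=> s t hs ht; rewrite lem_mlcm hs ht.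
- by move=> u uU; rewrite (bigD1 u) ?(subsetP sUV) //= lem_mlcml.
Qed.

End OrderMonomial.

Section Complex.
Context {disp : Order.disp_t} {P : finPOrderType disp} {n : nat}.
Variables (K : fieldType) (m : P -> 'X_{1..n}).
Local Notation S := {mpoly K[n]}.

(* S is regarded as a module over itself through the regular module [S^o];
   plain [S] carries its K-module structure. *)
Definition monomial_ideal : {pred S^o} :=
  fun p => boolp.asbool (exists q : P -> S, p = \sum_u q u * 'X_[m u]).

Fact monomial_ideal_submod : submod_closed monomial_ideal.
Proof.
split=> [|a p q /boolp.asboolP[s ->] /boolp.asboolP[t ->]]; apply/boolp.asboolP.
  by exists (fun=> 0); rewrite big1 // => u _; rewrite mul0r.
exists (fun u => a * s u + t u); rewrite [_ *: _]mulr_sumr -big_split /=.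
by apply: eq_bigr => u _; rewrite mulrDl mulrA.
Qed.

HB.instance Definition _ :=
  GRing.isSubmodClosed.Build S S^o monomial_ideal monomial_ideal_submod.

(* The free module S(-a) is the submodule x^a S of S. *)
Definition shift (a : 'X_{1..n}) : {pred S^o} :=
  fun p => boolp.asbool (exists q : S, p = 'X_[a] * q).

Fact shift_submod a : submod_closed (shift a).
Proof.
split=> [|c p q /boolp.asboolP[s ->] /boolp.asboolP[t ->]]; apply/boolp.asboolP.
  by exists 0; rewrite mulr0.
by exists (c * s + t); rewrite mulrDr [_ *: _]mulrCA.
Qed.

HB.instance Definition _ a :=
  GRing.isSubmodClosed.Build S S^o (shift a) (shift_submod a).

Lemma shiftS a b : (a <= b)%MM -> {subset shift b <= shift a}.
Proof.
move=> le_ab p /boolp.asboolP[q ->]; apply/boolp.asboolP.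
by exists ('X_[b - a] * q); rewrite mulrA -mpolyXD addmC submK.
Qed.

(* The direct sum over k-chains c of S(-a_c), as a submodule of S^(k-chains). *)
Definition order_summands k : {pred {ffun chain P k -> S^o}} :=
  fun f => [forall c, f c \in shift (lcm_mon m (chain_set c))].

Fact order_summands_submod k : submod_closed (@order_summands k).
Proof.
split=> [|a f g /forallP fS /forallP gS]; apply/forallP=> c; rewrite !ffunE.
  exact: rpred0.
by rewrite rpredD // rpredZ.
Qed.

HB.instance Definition _ k := GRing.isSubmodClosed.Build
  S {ffun chain P k -> S^o} (@order_summands k) (@order_summands_submod k).

Record order_term k := OrderTerm {
  order_term_val :> {ffun chain P k -> S^o};
  _ : order_term_val \in @order_summands k }.

HB.instance Definition _ k := [isSub for @order_term_val k].
HB.instance Definition _ k := [Choice of order_term k by <:].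
HB.instance Definition _ k := [SubChoice_isSubLmodule of order_term k by <:].

(* The inclusions E_i are identities on elements of S. Positions in chains are
   numbered from 0, hence the exponent [i.+1]. *)
Definition order_diff_ffun k (f : {ffun chain P k.+1 -> S^o}) :
    {ffun chain P k -> S^o} :=
  [ffun c => \sum_(c' : chain P k.+1) \sum_(i < k.+1 | chain_del c' i == c)
               (-1) ^+ i.+1 * f c'].

Fact order_diff_subproof k (f : order_term k.+1) :
  order_diff_ffun f \in @order_summands k.
Proof.
case: f => f /= /forallP fS; apply/forallP=> c; rewrite ffunE.
apply: rpred_sum => c' _; apply: rpred_sum => i /eqP <-.
apply: (@rpredZ S S^o); apply: shiftS (fS c').
exact/lcm_monS/chain_set_del.
Qed.

Definition order_diff k (f : order_term k.+1) : order_term k :=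
  OrderTerm (order_diff_subproof f).

Fact order_diff_linear k : linear (@order_diff k).
Proof.
move=> a f g; apply/val_inj/ffunP=> c; rewrite /= !ffunE.
rewrite [X in _ = X + _]mulr_sumr -big_split /=; apply: eq_bigr => c' _.
rewrite mulr_sumr -big_split /=; apply: eq_bigr => i _.
by rewrite !ffunE mulrDr [_ *: _]/(_ * _) mulrCA.
Qed.

HB.instance Definition _ k := GRing.isLinear.Build S (order_term k.+1)
  (order_term k) _ (@order_diff k) (@order_diff_linear k).

(* C_0 is the summand of the unique 0-chain, S(-0) = S. *)
Definition order_aug (f : order_term 0) : quotmod monomial_ideal :=
  quotmod_pi monomial_ideal (f (chain0 P)).

Fact order_aug_linear : linear order_aug.
Proof.
by move=> a f g; rewrite /order_aug /= !ffunE linearP.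
Qed.

HB.instance Definition _ := GRing.isLinear.Build S (order_term 0)
  (quotmod monomial_ideal) _ order_aug order_aug_linear.

End Complex.

Arguments order_term {disp P n} K m k.
Arguments order_diff {disp P n} K m k.
Arguments order_aug {disp P n} K m.
Arguments monomial_ideal {disp P n} K m.

(* Main.v *)
(** The differential preserves monomial degrees, so exactness can be checked on
    the strand of each monomial t. This strand is the augmented chain complex
    of the order complex of {u | m u divides t}. By (OM) this finite poset is
    directed, so it is empty or has a greatest element w; in the second case
    c |-> (-1)^(|c|+1) (c, w) is a contracting homotopy. Empty posets only
    occur for t outside the ideal. Identities between operators on chains are
    proved for their transposes, which act on all functions [seq P -> A] and
    so can be handled by induction on sequences.

    For minimality, the coefficient of x^(a_c) in the c-component of a boundary
    vanishes when no deletion preserves the lcm, and all other monomials of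
    S(-a_c) are divisible by some variable inside S(-a_c). *)

Require Import Defs.
From mathcomp Require Import all_boot all_order all_algebra.
From mathcomp Require Import mpoly.
From mathcomp Require boolp.

Set Implicit Arguments.
Unset Strict Implicit.
Unset Printing Implicit Defensive.

Import Order.TTheory GRing.Theory.
Local Open Scope ring_scope.

(** * Alternating deletion operator on functions of sequences *)

Section Coboundary.
Variables (T : eqType) (A : pzRingType).
Implicit Types (phi : seq T -> A) (s : seq T).

(** Transpose of the chain differential. Deletions behind the head sit one position further right,
    hence the minus sign before the recursive call. *)
Fixpoint coboundary phi s : A :=
  if s is x :: s' then - phi s' - coboundary (fun r => phi (x :: r)) s' else 0.

Lemma eq_coboundary phi psi s :
  (forall r, subseq r s -> phi r = psi r) -> coboundary phi s = coboundary psi s.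
Proof.
elim: s phi psi => // x s IHs phi psi eq_phi.
rewrite /= (eq_phi s) ?subseq_cons //; congr (_ - _); apply: IHs => r sub_rs.
by apply: eq_phi; rewrite /= eqxx.
Qed.

Lemma coboundaryB phi psi s :
  coboundary (fun r => phi r - psi r) s = coboundary phi s - coboundary psi s.
Proof.
elim: s phi psi => [|x s IHs] phi psi /=; first by rewrite subr0.
by rewrite IHs !opprD !opprK addrACA.
Qed.

Lemma coboundaryN phi s : coboundary (fun r => - phi r) s = - coboundary phi s.
Proof.
elim: s phi => [|x s IHs] phi /=; first by rewrite oppr0.
by rewrite IHs opprD.
Qed.

Lemma coboundary0 s : coboundary (fun=> 0) s = 0.
Proof. by elim: s => //= x s ->; rewrite subr0 oppr0. Qed.

(** The terms deleting the head first and those deleting it second cancel; the terms keeping it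
    vanish by induction. *)
Lemma coboundary_coboundary phi s : coboundary (coboundary phi) s = 0.
Proof.
elim: s phi => //= x s IHs phi.
by rewrite coboundaryB coboundaryN IHs subr0 subrr.
Qed.

Lemma coboundary_rcons phi s w :
  coboundary phi (rcons s w) =
  coboundary (fun r => phi (rcons r w)) s + (-1) ^+ (size s).+1 * phi s.
Proof.
elim: s phi => [|x s IHs] phi /=.
  by rewrite subr0 add0r expr1 mulN1r.
by rewrite IHs /= opprD addrA [in RHS]exprS mulN1r mulNr.
Qed.

Lemma coboundaryZ a phi s :
  coboundary (fun r => a * phi r) s = a * coboundary phi s.
Proof.
elim: s phi => [|x s IHs] phi /=; first by rewrite mulr0.
by rewrite IHs mulrBr mulrN.
Qed.

(** Every [r] obtained from [s] by one deletion satisfies [size r + 1 = size s], so the sign is a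
    common factor. *)
Lemma coboundary_sign phi s :
  coboundary (fun r => (-1) ^+ (size r).+1 * phi r) s =
  (-1) ^+ size s * coboundary phi s.
Proof.
elim: s phi => [|x s IHs] phi /=; first by rewrite mulr0.
rewrite (@eq_coboundary _ (fun r => -1 * ((-1) ^+ (size r).+1 * phi (x :: r)))).
  by rewrite coboundaryZ IHs mulN1r mulrBr mulrN !exprS !mulN1r !mulNr.
by move=> r _; rewrite /= exprS mulrA.
Qed.

Lemma coboundaryE phi s :
  coboundary phi s =
  \sum_(i < size s) (-1) ^+ i.+1 * phi (take i s ++ drop i.+1 s).
Proof.
elim: s phi => [|x s IHs] phi /=; first by rewrite big_ord0.
rewrite big_ord_recl /= drop0 expr1 mulN1r IHs -sumrN; congr (_ + _).
by apply: eq_bigr => i _; rewrite /= -mulNr -mulN1r -exprS.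
Qed.

End Coboundary.

(** * The contracting homotopy of a cone, transposed *)

Section Cone.
Context {disp : Order.disp_t} {P : porderType disp} (A : pzRingType).
Variable w : P.
Implicit Types (phi : seq P -> A) (s : seq P).

(* The transpose of the cone homotopy c |-> (-1)^(|c|+1) (c, w), where (c, w)
   is read as 0 when it is not a chain. *)
Definition cone phi s : A :=
  if sorted <%O (rcons s w) then (-1) ^+ (size s).+1 * phi (rcons s w) else 0.

(** If [(s, w)] is a chain, the deletions inside [s] cancel and the deletion of [w] returns [phi s].
    Otherwise [s] ends in [w], and only deleting that entry leaves a sequence to which [w] can be
    appended. *)
Lemma cone_homotopy phi s : sorted <%O s -> all (<= w)%O s ->
  cone (coboundary phi) s + coboundary (cone phi) s = phi s.
Proof.
have signK k (x : A) : (-1) ^+ k * ((-1) ^+ k * x) = x.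
  by rewrite mulrA -exprD addnn -mul2n exprM sqrrN expr1n expr1n mul1r.
move=> s_sorted s_le; rewrite {1}/cone; case: ifPn => [sw_sorted | ].
  rewrite coboundary_rcons mulrDr signK.
  rewrite (@eq_coboundary _ _ (cone phi)
             (fun r => (-1) ^+ (size r).+1 * phi (rcons r w))).
    by rewrite coboundary_sign exprS mulN1r mulNr addrAC addNr add0r.
  move=> r sub_rs; rewrite /cone ifT //.
  apply: (subseq_sorted lt_trans) sw_sorted.
  by rewrite -!cats1 cat_subseq.
(* The empty sequence always extends by [w]; for the others, failure to extend forces the last entry
   to equal [w]. *)
case/lastP: s s_sorted s_le => [|s x] //; rewrite all_rcons => sx_sorted.
case/andP=> /= le_xw s_le; rewrite add0r.
have -> : sorted <%O (rcons (rcons s x) w) = (x < w)%O.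
  rewrite -!cats1 -catA /=; case: s sx_sorted {s_le} => [|y s] /=.
    by rewrite andbT.
  by rewrite -cats1 !cat_path /= !andbT => /andP[-> ->].
rewrite lt_neqAle le_xw andbT negbK => /eqP eq_xw; rewrite {}eq_xw in sx_sorted *.
rewrite coboundary_rcons (@eq_coboundary _ _ _ (fun=> 0)).
  by rewrite coboundary0 add0r /cone sx_sorted signK.
move=> r _; rewrite /cone ifF //; apply/negbTE.
rewrite -!cats1 -catA; case: r => [|y r] /=; rewrite ?ltxx //.
by rewrite cat_path /= ltxx !andbF.
Qed.

End Cone.

(** * Boundary and cone on chains, via their transposes *)

Section ChainComplex.
Context {disp : Order.disp_t} {P : finPOrderType disp} (A : comPzRingType).
Implicit Types (phi : seq P -> A).

Lemma chain_delE k (c : chain P k.+1) (i : 'I_k.+1) :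
  val (chain_del c i) = take i (val c) ++ drop i.+1 (val c) :> seq P.
Proof.
have x0 := tnth (val c) ord0.
have sz_take : size (take i (val c)) = i by rewrite size_takel // size_tuple ltnW.
apply: (@eq_from_nth _ x0).
  rewrite size_cat size_drop sz_take !size_tuple subSS subnKC //.
  by rewrite -ltnS.
move=> j; rewrite size_tuple => lt_jk.
rewrite -(tnth_nth x0 (val (chain_del c i)) (Ordinal lt_jk)) tnth_mktuple.
rewrite (tnth_nth x0) nth_cat sz_take /= /bump nth_drop.
by case: ltnP => [lt_ji | le_ij]; rewrite ?nth_take // addSn subnKC.
Qed.

(** Kept generic in [A]: it is used over [S] for the differential and over [K] for the coefficients
    of a fixed monomial. *)
Definition boundary k (g : chain P k.+1 -> A) (c : chain P k) : A :=
  \sum_(c' : chain P k.+1) \sum_(i < k.+1 | chain_del c' i == c)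
     (-1) ^+ i.+1 * g c'.

(** A pair of a chain and a position contributes to exactly one face, so exchanging the sums
    suffices. *)
Lemma boundary_pairing k (g : chain P k.+1 -> A) phi :
  \sum_c boundary g c * phi (val c) = \sum_c g c * coboundary phi (val c).
Proof.
under eq_bigr => c _ do rewrite mulr_suml.
rewrite exchange_big /=; apply: eq_bigr => c' _.
under eq_bigr => c _ do rewrite mulr_suml big_mkcond /=.
rewrite exchange_big coboundaryE size_tuple mulr_sumr /=.
apply: eq_bigr => i _; rewrite -big_mkcond /=.
rewrite (big_pred1 (chain_del c' i)) => [|c]; last by rewrite /= eq_sym.
by rewrite chain_delE -mulrA mulrCA.
Qed.

(** Indicator functions turn identities between pairings into identities between coefficients. *)
Lemma dirac_pairing k (g : chain P k -> A) (c : chain P k) :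
  \sum_c' g c' * (tval (val c') == val c)%:R = g c.
Proof.
rewrite (bigD1 c) //= eqxx mulr1 big1 ?addr0 // => c' ne_c'c.
by rewrite val_eqE val_eqE (negbTE ne_c'c) mulr0.
Qed.

Lemma boundary_boundary k (g : chain P k.+2 -> A) c :
  boundary (boundary g) c = 0.
Proof.
rewrite -(dirac_pairing (boundary _) c).
rewrite (boundary_pairing _ (fun s => (s == val c)%:R)) boundary_pairing.
by rewrite big1 // => c' _; rewrite coboundary_coboundary mulr0.
Qed.

(** The sum has at most one term; being empty when [c'] does not end in [w], it supplies the value 0
    there. *)
Definition cone_chain w k (g : chain P k -> A) (c' : chain P k.+1) : A :=
  \sum_(c : chain P k | rcons (val c) w == val c' :> seq P) (-1) ^+ k.+1 * g c.

Lemma cone_pairing w k (g : chain P k -> A) phi :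
  \sum_c cone_chain w g c * phi (val c) = \sum_c g c * cone w phi (val c).
Proof.
rewrite /cone_chain.
under eq_bigr => c' _ do rewrite mulr_suml big_mkcond /=.
rewrite exchange_big; apply: eq_bigr => c _ /=; rewrite -big_mkcond /cone.
case: ifPn => [cw_sorted | cw_unsorted].
  have cw_size : size (rcons (val c) w) == k.+1 by rewrite size_rcons size_tuple.
  rewrite (big_pred1 (exist (fun c : k.+1.-tuple P => sorted <%O c)
             (Tuple cw_size) cw_sorted)).
    by rewrite size_tuple mulrCA mulrA.
  by move=> c'; rewrite /= -val_eqE -val_eqE eq_sym.
rewrite mulr0 big1 // => c' /eqP eq_cw; case/negP: cw_unsorted.
by rewrite eq_cw; exact: valP c'.
Qed.

(** The cycle condition is stated by pairing, so that it also makes sense for [k = 0], where it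
    holds automatically. *)
Lemma boundary_cone w k (g : chain P k -> A) c :
    (forall c, g c != 0 -> all (<= w)%O (val c)) ->
    (forall phi, \sum_c g c * coboundary phi (val c) = 0) ->
  boundary (cone_chain w g) c = g c.
Proof.
move=> g_le g_cycle; pose delta (s : seq P) : A := (s == val c)%:R.
rewrite -(dirac_pairing (boundary _) c) (boundary_pairing _ delta) cone_pairing.
(* The cycle condition tested on [cone w delta] provides the second term of the homotopy formula. *)
rewrite -[LHS]addr0 -[X in _ + X](g_cycle (cone w delta)) -big_split /=.
rewrite -(dirac_pairing g c); apply: eq_bigr => c' _; rewrite -mulrDr.
have [-> | /g_le c'_le] := eqVneq (g c') 0; first by rewrite !mul0r.
by rewrite cone_homotopy //; exact: valP c'.
Qed.

End ChainComplex.

(** * Greatest elements below a monomial *)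

Section OrderMonomialFamily.
Context {disp : Order.disp_t} {P : finPOrderType disp} {n : nat}.
Variable m : P -> 'X_{1..n}.

Lemma lcm_mon_le (U : {set P}) t :
  reflect {in U, forall u, (m u <= t)%MM} (lcm_mon m U <= t)%MM.
Proof.
apply: (iffP idP) => [le_t u uU | le_t].
  apply: lepm_trans le_t.
  by rewrite /lcm_mon (bigD1 u) //= lem_mlcml.
rewrite /lcm_mon; apply: (big_ind (fun s => (s <= t)%MM)) => //.
- by apply/mnm_lepP=> i; rewrite mnmE.
- by move=> r s hr hs; rewrite lem_mlcm hr hs.
Qed.

Definition top_below (t : 'X_{1..n}) : option P :=
  [pick w | (m w <= t)%MM && [forall v, (m v <= t)%MM ==> (v <= w)%O]].

(* An order monomial family restricts, below each monomial, to a directed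
   finite poset. *)
Lemma top_below_some u t : order_monomial_family m -> (m u <= t)%MM ->
  exists w, [/\ top_below t = Some w, (m w <= t)%MM
               & forall v, (m v <= t)%MM -> (v <= w)%O].
Proof.
move=> OM le_ut; rewrite /top_below; case: pickP => [w | no_top].
  by case/andP=> le_wt /forallP w_top; exists w; split=> // v /(implyP (w_top v)).
(* Take [w] with the largest down-set. Any [z] above both [v] and [w] with [m z] dividing [t] then
   has the same down-set, so [z <= w]. *)
case: (@arg_maxnP _ u (fun x => (m x <= t)%MM)
         (fun x => #|[pred v : P | (v <= x)%O]|)) => // w le_wt w_max.
have /negP[] := negbT (no_top w); rewrite le_wt; apply/forallP=> v.
apply/implyP=> le_vt; have [z [le_vz le_wz le_mz]] := OM v w.
have sub_wz : [pred v : P | (v <= w)%O] \subset [pred v : P | (v <= z)%O].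
  by apply/subsetP=> x; rewrite !inE => /le_trans; apply.
have [_ /esym] := subset_leqif_card sub_wz.
rewrite eqn_leq (subset_leq_card sub_wz).
rewrite [(_ <= _)%N](w_max z (le_mz _ le_vt le_wt)) => /subsetP sub_zw.
by apply: le_trans le_vz _; have := sub_zw z; rewrite !inE; apply.
Qed.

End OrderMonomialFamily.

(** * Polynomials and shifts described by coefficients *)

Section Mpoly.
Variables (n : nat) (K : fieldType).
Local Notation S := {mpoly K[n]}.

(** Assembles a polynomial from prescribed coefficients; [T] may be any list containing their
    support. *)
Lemma mcoeff_sum_mono (g : 'X_{1..n} -> K) (T : seq 'X_{1..n}) t :
  (forall s, g s != 0 -> s \in T) ->
  (\sum_(s <- undup T) g s *: 'X_[s] : S)@_t = g t.
Proof.
move=> gT; rewrite raddf_sum /=.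
under eq_bigr => s _ do rewrite mcoeffZ mcoeffX.
have [tT | tNT] := boolP (t \in T).
  rewrite (bigD1_seq t) ?mem_undup ?undup_uniq //= eqxx mulr1 big1 ?addr0 //.
  by move=> s /negbTE ->; rewrite mulr0.
rewrite big_seq big1 => [|s].
  by apply/esym/eqP; apply: contraNT tNT => /gT.
rewrite mem_undup; case: eqP => [-> | _]; last by rewrite mulr0.
by rewrite (negbTE tNT).
Qed.

Lemma mcoeffXM (q : S) a t : ('X_[a] * q)@_t != 0 -> (a <= t)%MM.
Proof.
rewrite mulrC -mcoeff_msupp (perm_mem (msuppMX _ _)).
by case/mapP=> s _ ->; exact: lem_addr.
Qed.

Lemma shiftP a (p : S) :
  reflect (forall t, p@_t != 0 -> (a <= t)%MM) (p \in @shift n K a).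
Proof.
apply: (iffP idP) => [/boolp.asboolP[q ->] t | le_a]; first exact: mcoeffXM.
apply/boolp.asboolP; exists (\sum_(t <- msupp p) p@_t *: 'X_[t - a]).
rewrite {1}[p]mpolyE mulr_sumr !big_seq; apply: eq_bigr => t.
rewrite mcoeff_msupp => /le_a le_at.
by rewrite -scalerAr -mpolyXD addmC submK.
Qed.

End Mpoly.

(** * The order complex and its strands *)

Section OrderComplex.
Context {disp : Order.disp_t} {P : finPOrderType disp} {n : nat}.
Variables (K : fieldType) (m : P -> 'X_{1..n}).
Local Notation S := {mpoly K[n]}.
Local Notation C := (order_term K m).
Local Notation d := (order_diff K m).
Local Notation a_ c := (lcm_mon m (chain_set c)).

Lemma chain_lcm_le k (c : chain P k) t :
  (a_ c <= t)%MM = all (fun u => (m u <= t)%MM) (val c).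
Proof.
apply/lcm_mon_le/allP => [le_t u uc | le_t u]; first by apply: le_t; rewrite inE.
by rewrite inE; exact: le_t.
Qed.

Lemma order_summandsP k (f : {ffun chain P k -> S^o}) :
  reflect (forall c t, (f c : S)@_t != 0 -> (a_ c <= t)%MM)
    (f \in @order_summands _ P n K m k).
Proof.
apply: (iffP forallP) => [fS c t | f_le c]; first exact/shiftP/fS.
by apply/shiftP => t; exact: f_le.
Qed.

Lemma order_term_le k (x : C k) c t : (x c : S)@_t != 0 -> (a_ c <= t)%MM.
Proof. by move: c t; apply/order_summandsP; case: x. Qed.

Lemma order_diffE k (x : C k.+1) c : (d k x c : S) = boundary (A := S) x c.
Proof. by rewrite /= ffunE. Qed.

Lemma mcoeff_boundary k (f : chain P k.+1 -> S) c t :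
  (boundary f c)@_t = boundary (fun c' => (f c')@_t) c.
Proof.
rewrite /boundary raddf_sum; apply: eq_bigr => c' _.
by rewrite raddf_sum; apply: eq_bigr => i _; rewrite raddfMsign.
Qed.

Lemma order_diff_diff k (x : C k.+2) : d k (d k.+1 x) = 0.
Proof.
apply/val_inj/ffunP=> c; rewrite [LHS]order_diffE !ffunE.
rewrite -[RHS](boundary_boundary (A := S) x c); apply: eq_bigr => c' _.
by apply: eq_bigr => i _; rewrite order_diffE.
Qed.

(** Common core of exactness in all degrees. The preimage is given coefficientwise: at [t] it is the
    cone over [x] with apex the greatest element below [t]. *)
Lemma order_term_exact k (x : C k) : order_monomial_family m ->
    (forall c t, (x c : S)@_t != 0 -> exists u, (m u <= t)%MM) ->
    (forall t phi, \sum_c (x c : S)@_t * coboundary phi (val c) = 0) ->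
  exists y, d k y = x.
Proof.
move=> OM x_below x_cycle.
pose g (c' : chain P k.+1) t : K :=
  if top_below m t is Some w then cone_chain w (fun c => (x c : S)@_t) c' else 0.
(* All monomials of all components of [x]; by [gP] they contain the support of every [g c']. *)
pose T := flatten [seq msupp (x c : S) | c : chain P k].
have gP c' t : g c' t != 0 ->
    exists w (c : chain P k), [/\ top_below m t = Some w, rcons (val c) w = val c' :> seq P
                  & (x c : S)@_t != 0].
  rewrite /g; case: (top_below m t) => [w|]; last by rewrite eqxx.
  move=> nz_g; have [c /andP[/eqP eq_cw nz_x]] :
      exists c : chain P k, (rcons (val c) w == val c' :> seq P) && ((x c : S)@_t != 0).
    apply/existsP; apply: contraNT nz_g => /existsPn nog.
    rewrite /cone_chain big1 // => c eq_cw; move: (nog c).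
    by rewrite eq_cw negbK => /eqP ->; rewrite mulr0.
  by exists w, c.
pose y0 : {ffun chain P k.+1 -> S^o} :=
  [ffun c' => \sum_(t <- undup T) g c' t *: 'X_[t] : S].
have y0E c' t : (y0 c' : S)@_t = g c' t.
  rewrite ffunE mcoeff_sum_mono // => s /gP[w [c [_ _ nz_x]]].
  by apply/flatten_mapP; exists c; rewrite ?mem_enum // mcoeff_msupp.
have y0S : y0 \in @order_summands _ P n K m k.+1.
  apply/order_summandsP => c' t; rewrite y0E => /gP[w [c [top_w eq_cw nz_x]]].
  have [u le_ut] := x_below _ _ nz_x.
  have [w' [top_w' le_w't _]] := top_below_some OM le_ut.
  rewrite chain_lcm_le -eq_cw all_rcons -chain_lcm_le (order_term_le nz_x) andbT.
  by move: top_w'; rewrite top_w => -[->].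
exists (OrderTerm y0S); apply/val_inj/ffunP => c.
rewrite [LHS]order_diffE; apply/mpolyP => t; rewrite mcoeff_boundary.
have -> : boundary (fun c' => (y0 c' : S)@_t) c = boundary (g^~ t) c.
  by apply: eq_bigr => c' _; apply: eq_bigr => i _; rewrite y0E.
have [[u le_ut] | no_u] := boolp.pselect (exists u, (m u <= t)%MM).
  have [w [top_w _ w_top]] := top_below_some OM le_ut.
  rewrite /g top_w boundary_cone // => c' nz_x.
  have := order_term_le nz_x; rewrite chain_lcm_le.
  by apply: sub_all => v; exact: w_top.
(* When no [m u] divides [t], neither [x] nor [g] has a coefficient at [t]. *)
have x0 c' : (x c' : S)@_t = 0.
  by apply/eqP; apply: contra_notT no_u; exact: x_below.
rewrite x0 /boundary big1 // => c' _; rewrite big1 // => i _.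
suff /eqP -> : g c' t == 0 by rewrite mulr0.
by apply: contraT => /gP[w [c'' [_ _]]]; rewrite x0 eqxx.
Qed.

Lemma order_diff_exact k (x : C k.+1) : order_monomial_family m ->
  d k x = 0 <-> exists y, d k.+1 y = x.
Proof.
move=> OM; split=> [dx0 | [y <-]]; last exact: order_diff_diff.
(* In positive degree, the first entry of the chain supplies the required [u]. *)
apply: order_term_exact => // [c t /order_term_le | t phi].
  rewrite chain_lcm_le => /allP le_t; exists (tnth (val c) ord0).
  exact/le_t/mem_tnth.
rewrite -boundary_pairing big1 // => c _.
by rewrite -mcoeff_boundary -order_diffE dx0 ffunE mcoeff0 mul0r.
Qed.

(** * Augmentation and exactness at [C 0] *)

Lemma monomial_ideal_below (p : S) t :
  p \in monomial_ideal K m -> p@_t != 0 -> exists u, (m u <= t)%MM.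
Proof.
move=> /boolp.asboolP[q ->] nz_t.
suff /existsP : [exists u, (m u <= t)%MM] by [].
apply: contraNT nz_t => /existsPn no_u; rewrite raddf_sum big1 //= => u _.
by apply: contraNeq (no_u u); rewrite mulrC; exact: mcoeffXM.
Qed.

Lemma monomial_idealX (p : S) u t : (m u <= t)%MM ->
  'X_[t] * p \in monomial_ideal K m.
Proof.
move=> le_ut; apply/boolp.asboolP.
exists (fun v => if v == u then p * 'X_[t - m u] else 0).
rewrite (bigD1 u) //= eqxx big1 => [|v /negbTE ->]; last by rewrite mul0r.
by rewrite addr0 -mulrA -mpolyXD submK // mulrC.
Qed.

Lemma order_aug_eq0 (x : C 0) :
  order_aug K m x = 0 <-> (x (chain0 P) : S) \in monomial_ideal K m.
Proof.
have := quotmod_piP (monomial_ideal K m) (x (chain0 P)) 0.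
by rewrite subr0 raddf0 => /rwP ->.
Qed.

Lemma chain0_eq (c : chain P 0) : c = chain0 P.
Proof. by apply/val_inj/val_inj/size0nil; rewrite size_tuple. Qed.

Lemma order_aug_exact (x : C 0) : order_monomial_family m ->
  order_aug K m x = 0 <-> exists y, d 0 y = x.
Proof.
move=> OM; split=> [/order_aug_eq0 xI | [y <-]].
  (* Membership in the ideal supplies [u]; the cycle condition is trivial, as the coboundary
     vanishes on the empty chain. *)
  apply: order_term_exact => // [c t | t phi].
    by rewrite (chain0_eq c); exact: monomial_ideal_below.
  by rewrite big1 // => c _; rewrite (chain0_eq c) mulr0.
apply/order_aug_eq0; rewrite order_diffE.
apply: (@rpred_sum _ (monomial_ideal K m)) => c' _.
apply: (@rpred_sum _ (monomial_ideal K m)) => i _.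
apply: (@rpredZ S S^o (monomial_ideal K m)).
case: y => y /= /forallP/(_ c')/boolp.asboolP[q ->].
apply: (@monomial_idealX _ (tnth (val c') ord0)).
have := lepm_refl (a_ c'); rewrite {1}chain_lcm_le => /allP; apply.
exact: mem_tnth.
Qed.

Lemma order_aug_surj v : exists x, order_aug K m x = v.
Proof.
have [p ->] := quotmod_repr v.
have pS : [ffun=> p] \in @order_summands _ P n K m 0.
  apply/order_summandsP => c t _; rewrite chain_lcm_le.
  by rewrite (chain0_eq c).
by exists (OrderTerm pS); rewrite /order_aug ffunE.
Qed.

(** * Freeness and minimality *)

Lemma order_term_sum k (I : finType) (F : I -> C k) c :
  ((\sum_i F i) c : S) = \sum_i (F i c : S).
Proof.
by apply: (big_morph (fun x : C k => x c : S)) => [x y|]; rewrite /= ffunE.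
Qed.

Lemma order_term_free k : finite_free (C k).
Proof.
(* The basis element of [c] is the generator of its summand, extended by zero. *)
have eS (c : chain P k) : [ffun c' => ('X_[a_ c] *+ (c' == c) : S)]
    \in @order_summands _ P n K m k.
  apply/order_summandsP => c' t; rewrite ffunE.
  have [-> | _] := eqVneq c' c; last by rewrite mulr0n mcoeff0 eqxx.
  rewrite mulr1n mcoeffX.
  by have [<- | _] := eqVneq (a_ c) t; rewrite ?lepm_refl ?eqxx.
exists (chain P k : finType), (fun c => OrderTerm (eS c)) => v.
have sumE (q : {ffun chain P k -> S}) c :
    ((\sum_c' q c' *: OrderTerm (eS c')) c : S) = q c * 'X_[a_ c].
  rewrite order_term_sum (bigD1 c) //= big1 => [|c' /negbTE ne_c'c].
    by rewrite !ffunE eqxx addr0.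
  by rewrite !ffunE eq_sym ne_c'c mulr0n scaler0.
have /fin_all_exists[q qE] : forall c, exists q : S, (v c : S) = 'X_[a_ c] * q.
  by move=> c; case: v => v /= /forallP/(_ c)/boolp.asboolP.
exists (finfun q); split.
  by apply/val_inj/ffunP => c; rewrite [RHS]sumE ffunE qE mulrC.
move=> q' def_v; apply/ffunP => c; rewrite ffunE.
have nzX : 'X_[a_ c] != 0 :> S by rewrite -msupp_eq0 msuppX.
by apply: (mulIf nzX); rewrite -sumE -def_v qE mulrC.
Qed.

(** Each monomial in component [c] is then a proper multiple of the generator, so some variable
    divides out within the summand. [var] picks one such variable, so that no term is counted
    twice. *)
Lemma order_term_irrelevant k (z : C k) :
    (forall c, (z c : S)@_(a_ c) = 0) ->
  exists y : 'I_n -> C k, z = \sum_(i < n) ('X_i : S) *: y i.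
Proof.
move=> z0; pose var (c : chain P k) (t : 'X_{1..n}) i :=
  [pick i : 'I_n | (a_ c i < t i)%N] == Some i.
pose y0 (i : 'I_n) : {ffun chain P k -> S^o} :=
  [ffun c => \sum_(t <- msupp (z c : S) | var c t i)
               (z c : S)@_t *: 'X_[t - U_(i)] : S].
have y0S i : y0 i \in @order_summands _ P n K m k.
  apply/forallP => c; rewrite ffunE big_seq_cond.
  apply: rpred_sum => t /andP[]; rewrite mcoeff_msupp => /order_term_le le_ct.
  rewrite /var; case: pickP => // j lt_j /eqP[<-].
  apply/shiftP => s; rewrite mcoeffZ mcoeffX mulf_eq0 negb_or => /andP[_].
  have [<- _ | _] := eqVneq (t - U_(j))%MM s; last by rewrite eqxx.
  apply/mnm_lepP => l; rewrite mnmBE mnm1E; case: eqP => [<- | _].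
    by rewrite leq_subRL ?add1n // (leq_trans _ lt_j).
  by rewrite subn0; exact: mnm_lepP.
exists (fun i => OrderTerm (y0S i)); apply/val_inj/ffunP => c.
rewrite [RHS]order_term_sum [LHS](mpolyE (z c)).
under [RHS]eq_bigr => i _.
  rewrite /= !ffunE [_ *: _]mulr_sumr big_mkcond /=; over.
rewrite exchange_big !big_seq /=; apply: eq_bigr => t.
rewrite mcoeff_msupp => nz_t; rewrite -big_mkcond /var /=.
case: pickP => [i lt_i | no_i].
  rewrite (big_pred1 i) => [|j]; last by rewrite /= eq_sym.
  rewrite -scalerAr -mpolyXD addmC submK //.
  apply/mnm_lepP => l; rewrite mnm1E; case: eqP => // <-.
  exact: leq_ltn_trans lt_i.
(* Without such a variable [t] is the exponent of the generator, whose coefficient is zero. *)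
have le_ct := order_term_le nz_t; case/eqP: nz_t; rewrite -(z0 c).
congr (_@__); apply/mnmP => i; apply/eqP.
by rewrite eqn_leq (mnm_lepP le_ct) leqNgt no_i.
Qed.

(** A contribution of [c'] to the generator of its face [c] would make the lcm of [c'] divide that
    of [c], forcing equality. *)
Lemma order_diff_minimal k (x : C k.+1) :
    (forall (c : chain P k.+1) i, a_ c <> a_ (chain_del c i)) ->
  exists y : 'I_n -> C k, d k x = \sum_(i < n) ('X_i : S) *: y i.
Proof.
move=> neq_a; apply: order_term_irrelevant => c.
rewrite order_diffE mcoeff_boundary /boundary big1 // => c' _.
rewrite big1 // => i /eqP def_c; apply/eqP; rewrite mulf_eq0; apply/orP; right.
apply: contraT => /order_term_le; rewrite -def_c => le_a.
case: (neq_a c' i); apply/mnmP => j; apply/eqP; rewrite eqn_leq.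
rewrite (mnm_lepP le_a); apply/mnm_lepP.
exact/lcm_monS/chain_set_del.
Qed.

End OrderComplex.

Theorem theorem6p1 (K : fieldType) (n : nat) (disp : Order.disp_t)
    (P : finPOrderType disp) (m : P -> 'X_{1..n}) :
  order_monomial_family m ->
  @free_resolution {mpoly K[n]} (order_term K m) (order_diff K m)
    (quotmod (monomial_ideal K m)) (order_aug K m) /\
  ((forall (k : nat) (c : chain P k.+1) (i : 'I_k.+1),
      lcm_mon m (chain_set c) <> lcm_mon m (chain_set (chain_del c i))) ->
   @minimal_free_resolution K n (order_term K m) (order_diff K m)
     (quotmod (monomial_ideal K m)) (order_aug K m)).
Proof.
move=> OM; have res : @free_resolution {mpoly K[n]} (order_term K m)
    (order_diff K m) (quotmod (monomial_ideal K m)) (order_aug K m).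
  split=> [k | v | x | k x].
  - exact: order_term_free.
  - exact: order_aug_surj.
  - exact: order_aug_exact.
  - exact: order_diff_exact.
split=> // neq_a; split=> // k x.
by apply: order_diff_minimal => c i; exact: neq_a.
Qed.
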